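(* Let $n\ge1$ and $f(u)=|u|^{4/n}u\,e^{u^2}$. There exist constants $\varepsilon=\varepsilon(n)>0$ and $C=C(n)>0$ such that the following holds. Let $\varphi\in\exp L^2$ with $\varphi\ge0$, and assume that there exists a unique positive solution $u$ of the Cauchy problem $\partial_tu=\Delta u+f(u)$, $u(0)=\varphi$, satisfying $$\sup_{t>0}\|u(t)\|_{\exp L^2}\le2\|\varphi\|_{\exp L^2}.$$ If $\|\varphi\|_{\exp L^2}<\varepsilon$, then for all $q\in[2,\infty]$, $$\|u(t)\|_{L^q}\le C\,t^{-\frac n2\left(\frac12-\frac1q\right)}\|\varphi\|_{\exp L^2},\qquad t>0.$$
   Context: Orlicz space: $\exp L^2=\exp L^2(\mathbb{R}^n)$ is the space of $u\in L^1_{loc}(\mathbb{R}^n)$ such that $\int_{\mathbb{R}^n}(\exp((|u(x)|/\lambda)^2)-1)\,dx<\infty$ for some $\lambda>0$, with the Luxemburg norm $\|u\|_{\exp L^2}=\inf\{\lambda>0:\int_{\mathbb{R}^n}(\exp((|u(x)|/\lambda)^2)-1)\,dx\le1\}$. Weak$^*$ convergence: the predual of $\exp L^2$ is the Orlicz space of the complementary function $\tilde A(t)=\sup_{s\ge0}(ts-A(s))$ of $A(s)=e^{s^2}-1$. ''$u(t)\to\varphi$ in the weak$^*$ topology as $t\to0$'' means $\lim_{t\to0}\int_{\mathbb{R}^n}(u(t,x)-\varphi(x))\psi(x)\,dx=0$ for every $\psi$ in this predual. Heat semigroup: $e^{t\Delta}\varphi=G_2(t,\cdot)*\varphi$ with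 $G_2(t,x)=(4\pi t)^{-n/2}e^{-|x|^2/(4t)}$. Solution: ''solution'' means mild solution in $(0,\infty)\times\mathbb{R}^n$: $u\in L^\infty(0,\infty;\exp L^2)\cap C((0,\infty);\exp L^2)$, $u(t)=e^{t\Delta}\varphi+\int_0^te^{(t-s)\Delta}f(u(s))\,ds$ for $t>0$, and $u(t)\to\varphi$ in the weak$^*$ topology as $t\to0$. $L^q=L^q(\mathbb{R}^n)$. *)

(* Defs.v *)
From HB Require Import structures.
From mathcomp Require Import all_boot all_order all_algebra.
From mathcomp Require Import all_classical all_reals all_analysis.

Set Implicit Arguments.
Unset Strict Implicit.
Unset Printing Implicit Defensive.

Import Order.TTheory GRing.Theory Num.Theory.
Import numFieldNormedType.Exports.

Local Open Scope classical_set_scope.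
Local Open Scope ring_scope.

(* The sigma-algebra on n-tuples is the library's one, generated by the
   coordinates, i.e. the Borel sigma-algebra of R^n. *)
Notation euclidean R n := (n.-tuple (measurableTypeR R)).

Section lebesgue_step.
Context {R : realType} {n : nat}.
Variable m : {sigma_finite_measure set (euclidean R n) -> \bar R}.

Definition tcons (p : measurableTypeR R * euclidean R n) : euclidean R n.+1 :=
  [tuple of p.1 :: p.2].

Lemma measurable_tcons : measurable_fun setT tcons.
Proof. exact: (@measurable_cons _ _ _ _ fst n snd). Qed.

Definition lebesgue_step : set (euclidean R n.+1) -> \bar R :=
  pushforward (@lebesgue_measure R \x m)%E tcons.

Let lebesgue_step0 : lebesgue_step set0 = 0%E.
Proof. by rewrite /lebesgue_step /pushforward preimage_set0 measure0. Qed.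

Let lebesgue_step_ge0 A : (0 <= lebesgue_step A)%E.
Proof. exact: (measure_ge0 (@lebesgue_measure R \x m)%E). Qed.

Let lebesgue_step_sigma_additive : semi_sigma_additive lebesgue_step.
Proof.
move=> F mF tF mUF; rewrite /lebesgue_step /pushforward preimage_bigcup.
apply: (@measure_semi_sigma_additive _ _ _ (@lebesgue_measure R \x m)%E).
- by move=> i; rewrite -[X in measurable X]setTI; exact: measurable_tcons.
- apply/trivIsetP => /= i j _ _ ij; rewrite -preimage_setI.
  by move/trivIsetP : tF => /(_ _ _ _ _ ij) ->//; rewrite preimage_set0.
- by rewrite -preimage_bigcup -[X in measurable X]setTI; exact: measurable_tcons.
Qed.

HB.instance Definition _ := isMeasure.Build _ _ _ lebesgue_step
  lebesgue_step0 lebesgue_step_ge0 lebesgue_step_sigma_additive.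

Let lebesgue_step_sigma_finite : sigma_finite setT lebesgue_step.
Proof.
have /sigma_finiteP[F [TF ndF mF]] := sigma_finiteT (@lebesgue_measure R).
have /sigma_finiteP[G [TG ndG mG]] := sigma_finiteT m.
exists (fun k => [set x | F k (thead x) /\ G k [tuple of behead x]]).
  apply/esym; rewrite -subTset => x _.
  have : setT (thead x) by []; have : setT [tuple of behead x] by [].
  rewrite TF TG => -[j _ Gj] [i _ Fi]; exists (maxn i j) => //; split.
    by move: Fi; apply/subsetPset/ndF/leq_maxl.
  by move: Gj; apply/subsetPset/ndG/leq_maxr.
move=> k; have [mFk Fkoo] := mF k; have [mGk Gkoo] := mG k; split.
  apply: measurableI.
    rewrite -[X in measurable X]setTI.
    exact: (@measurable_tnth _ (measurableTypeR R) n.+1 ord0).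
  rewrite -[X in measurable X]setTI.
  exact: (@measurable_behead _ (measurableTypeR R) n).
rewrite /lebesgue_step /pushforward (_ : _ @^-1` _ = F k `*` G k).
  by rewrite product_measure1E// lte_mul_pinfty// ge0_fin_numE.
have K p : [tuple of behead (tcons p)] = p.2 by apply: val_inj.
by apply/seteqP; split => -[a x]; rewrite /preimage /= K.
Qed.

HB.instance Definition _ :=
  Measure_isSigmaFinite.Build _ _ _ lebesgue_step lebesgue_step_sigma_finite.

End lebesgue_step.

Fixpoint lebesgueRn (R : realType) (n : nat) :
    {sigma_finite_measure set (euclidean R n) -> \bar R} :=
  match n with
  | 0 => \d_([tuple] : euclidean R 0)
  | n'.+1 => lebesgue_step (lebesgueRn R n')
  end.

Section definitions.
Context {R : realType} {n : nat}.
Local Notation E := (euclidean R n).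
Local Notation mu := (lebesgueRn R n).
Implicit Types (A : R -> \bar R) (g h phi psi : E -> R) (u : R -> E -> R).

Definition enorm (x : E) : R := Num.sqrt (\sum_(i < n) tnth x i ^+ 2).

Definition esub (x y : E) : E := [tuple tnth x i - tnth y i | i < n].

Definition L1loc g : Prop :=
  measurable_fun setT g /\
  forall r : R, (\int[mu]_(x in [set x | (enorm x <= r)%R]) `|g x|%:E < +oo)%E.

Definition modular A (lambda : R) g : \bar R :=
  (\int[mu]_x A (`|g x| / lambda)%R)%E.

(* Functions stand for their almost everywhere classes. *)
Definition orlicz A g : Prop :=
  L1loc g /\
  exists2 lambda : R, 0 < lambda & (modular A lambda g < +oo)%E.

Definition luxemburg A g : \bar R :=
  ereal_inf [set lambda%:E | lambda in
    [set lambda : R | 0 < lambda /\ (modular A lambda g <= 1)%E]].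

Definition complementary A (t : R) : \bar R :=
  ereal_sup [set ((t * s)%:E - A s)%E | s in [set s : R | 0 <= s]].

Definition young_exp2 (s : R) : \bar R := (expR (s ^+ 2) - 1)%:E.

Definition expL2 g : Prop := orlicz young_exp2 g.

Definition expL2_norm g : \bar R := luxemburg young_exp2 g.

Definition expL2_predual psi : Prop := orlicz (complementary young_exp2) psi.

Definition weak_star_cvg0 u phi : Prop :=
  forall psi, expL2_predual psi ->
    (fun t : R => \int[mu]_x ((u t x - phi x) * psi x)%:E)%E @ 0^'+ --> 0%E.

Definition heat_kernel (t : R) (x : E) : R :=
  (4 * pi * t) `^ (- (n%:R / 2)) * expR (- (enorm x ^+ 2 / (4 * t))).

Definition convolution g h (x : E) : \bar R :=
  (\int[mu]_y (g (esub x y) * h y)%:E)%E.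

(* Extended-real valued because f (u s) need not be integrable against the
   kernel; finiteness is then enforced by the Duhamel equation below. *)
Definition heat (t : R) g : E -> \bar R := convolution (heat_kernel t) g.

(* The values u t with t <= 0 are irrelevant. *)
Definition mild_solution (f : R -> R) phi u : Prop :=
  [/\ forall t : R, 0 < t -> expL2 (u t),
      exists M : R, {ae @lebesgue_measure R, forall t : R,
        0 < t -> (expL2_norm (u t) <= M%:E)%E},
      forall t0 : R, 0 < t0 ->
        expL2_norm (fun x => u t x - u t0 x) @[t --> t0] --> 0%E,
      forall t : R, 0 < t -> {ae mu, forall x,
        (u t x)%:E = (heat t phi x +
          \int[@lebesgue_measure R]_(s in `]0%R, t[)
             heat (t - s)%R (fun y => f (u s y)) x)%E} &
      weak_star_cvg0 u phi].

Definition positive_in_time u : Prop :=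
  forall t : R, 0 < t -> {ae mu, forall x, 0 <= u t x}.

Definition nonlinearity (v : R) : R :=
  `|v| `^ (4 / n%:R) * v * expR (v ^+ 2).

Definition admissible_solution phi u : Prop :=
  [/\ mild_solution nonlinearity phi u,
      positive_in_time u &
      (ereal_sup [set expL2_norm (u t) | t in [set t : R | (0 < t)%R]]
         <= 2%:E * expL2_norm phi)%E].

Definition unique_admissible_solution phi u : Prop :=
  admissible_solution phi u /\
  forall v, admissible_solution phi v ->
    forall t : R, 0 < t -> {ae mu, forall x, v t x = u t x}.

End definitions.

Arguments nonlinearity {R} n v.

(* Main.v *)
Require Import Defs.
From mathcomp Require Import all_boot all_order all_algebra.
From mathcomp Require Import all_classical all_reals all_analysis.
From mathcomp Require Import measurable_realfun ess_sup_inf ring lra.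

Set Implicit Arguments.
Unset Strict Implicit.
Unset Printing Implicit Defensive.

Import Order.TTheory GRing.Theory Num.Theory.
Import numFieldNormedType.Exports.

Local Open Scope classical_set_scope.
Local Open Scope ring_scope.

(** The Luxemburg bound gives the L^2 bound of [u t], so by interpolation it is
    enough to prove [|u t| <= 3 d t^(-n/4)] almost everywhere for every [d]
    slightly above the norm of [phi]. The linear part of the Duhamel formula
    contributes [2 d t^(-n/4)]. In the integral part, the exponential moments
    bound [f (u s)] in L^n by [C d^(1+4/n)], which handles [t <= 2]. For [t > 2]
    the decay already known at earlier times bounds [f (u s)] in L^r with
    [r = (2n+4)/(n+4)] for [s < t/2] and in L^oo for [t/2 <= s <= t - eta]; the
    remaining [s > t - eta] are covered by the L^n bound, whose contribution
    tends to 0 with [eta]. As [eta] depends only on the final time, the decay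
    propagates by steps of length [eta]. *)

(* Monotonicity without measurability: the Duhamel integrand of a mild solution
   is not known to be measurable in time. *)
Lemma le_integral_nnfun d (T : measurableType d) (R : realType)
    (mu : {measure set T -> \bar R}) (D : set T) (f g : T -> \bar R) :
  (forall x, D x -> (f x <= g x)%E) -> (forall x, D x -> (0 <= g x)%E) ->
  (\int[mu]_(x in D) f x <= \int[mu]_(x in D) g x)%E.
Proof.
move=> fg g0; rewrite integralE.
have fg' x : D x -> (f^\+ x <= g x)%E.
  by move=> Dx; rewrite funeposE ge_max fg// g0.
apply: (@le_trans _ _ (\int[mu]_(x in D) (f^\+ x))%E).
  by rewrite -[leRHS]sube0 leeB// integral_ge0.
rewrite !ge0_integralE//; apply: le_ereal_sup => _ [h /= hf <-].
exists h => // x; apply: le_trans (hf x) _.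
by rewrite /patch; case: ifPn => // /set_mem /fg'.
Qed.

(** * Time integrals with singular endpoints *)

(** The fundamental theorem of calculus is applied on compact subintervals exhausting []a, b[], and
    monotone convergence gives the limit. Only increments of [F] between interior points are
    controlled, so [f] and [F] may be singular at both ends. *)
Lemma integral_itv_le (R : realType) (f F : R -> R) (a b K : R) :
  a < b ->
  (forall s, a < s < b -> 0 <= f s) ->
  (forall s, a < s < b -> {for s, continuous f}) ->
  (forall s, a < s < b -> is_derive s 1 F (f s)) ->
  (forall c e, a < c -> c < e -> e < b -> F e - F c <= K) ->
  (\int[@lebesgue_measure R]_(s in `]a, b[) (f s)%:E <= K%:E)%E.
Proof.
move=> ab f0 fc dF FK.
(* The margin is at most a third of the length, so every [[a + h k, b - h k]] is nondegenerate,
   already for [k = 0]. *)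
pose h (k : nat) := (b - a) / k.+3%:R.
have ba : 0 < b - a by rewrite subr_gt0.
have h0 k : 0 < h k by rewrite divr_gt0.
have h3 k : h k *+ 3 <= b - a.
  have k3 : (3 : R) <= k.+3%:R by rewrite ler_nat.
  by rewrite -mulr_natr mulrAC ler_pdivrMr// ler_wpM2l// ltW.
pose A k : set R := `[a + h k, b - h k]%classic.
have hdec i j : (i <= j)%N -> h j <= h i.
  move=> ij; rewrite ler_pM2l// lef_pV2 ?posrE// ler_nat.
  by rewrite !ltnS.
have AE : `]a, b[%classic = \bigcup_k A k.
  apply/seteqP; split => [s /=|s [k _]]; last first.
    rewrite /A /= !in_itv/= => /andP[k1 k2]; move: (h0 k) => ?.
    by apply/andP; split; lra.
  rewrite in_itv/= => /andP[a_s sb].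
  pose m := Num.min (s - a) (b - s).
  have m0 : 0 < m by rewrite lt_min !subr_gt0 a_s sb.
  pose k := Num.trunc ((b - a) / m).
  exists k => //; rewrite /A /= in_itv/=.
  have : h k <= m.
    rewrite ler_pdivrMr// mulrC -ler_pdivrMr// ltW//.
    apply: lt_le_trans (truncnS_gt _) _; by rewrite ler_nat !ltnS -addn2 leq_addr.
  rewrite le_min => /andP[k1 k2]; apply/andP; split; lra.
have Asub k s : A k s -> a < s < b.
  move=> As; have : `]a, b[%classic s by rewrite AE; exists k.
  by rewrite /= in_itv.
have cA k : {within A k, continuous f}.
  by apply: continuous_in_subspaceT => s; rewrite inE => /Asub; exact: fc.
have mf k : measurable_fun (A k) f.
  apply: subspace_continuous_measurable_fun (cA k); exact: measurable_itv.
rewrite AE.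
have cvg : (\int[@lebesgue_measure R]_(x in A i) (f x)%:E @[i --> \oo]
   --> \int[@lebesgue_measure R]_(x in \bigcup_i A i) (f x)%:E)%E.
  apply: ge0_nondecreasing_set_cvg_integral => //.
  - move=> i j ij; apply/subsetPset => s; rewrite /A /= !in_itv/=.
    move: (hdec _ _ ij) => ? /andP[? ?]; apply/andP; split; lra.
  - by move=> k; exact: measurable_itv.
  - by move=> k; apply/measurable_EFinP; exact: mf.
  - by move=> k s /Asub/f0; rewrite /= lee_fin.
rewrite -(cvg_lim _ cvg)//; apply: lime_le.
  by apply/cvg_ex; eexists; exact: cvg.
apply: nearW => k.
have ? := h0 k; have := h3 k; rewrite -mulr_natr => ?.
have abk : a + h k < b - h k by lra.
rewrite (@continuous_FTC2 _ f F) //.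
- by rewrite -EFinB lee_fin FK//; lra.
- exact: cA.
- have dcF s : a < s < b -> {for s, continuous F}.
    move=> /dF [+ _]; move/derivable1_diffP; exact: differentiable_continuous.
  split => [s|/=|/=].
  + rewrite in_itv/= => /andP[? ?].
    by have [] := dF s => //; apply/andP; split; lra.
  + apply: cvg_at_right_filter; apply: dcF; apply/andP; split; lra.
  + apply: cvg_at_left_filter; apply: dcF; apply/andP; split; lra.
- move=> s; rewrite in_itv/= => /andP[? ?].
  by rewrite derive1E; have [] := dF s => //; apply/andP; split; lra.
Qed.

Lemma integral_singular_le (R : realType) (A B D b c t : R) :
  0 <= A -> 0 <= B -> 0 <= D -> b < 1 -> c < 1 -> 0 < t ->
  (\int[@lebesgue_measure R]_(s in `]0%R, t[)
     (A * s `^ (- b) + B + D * (t - s) `^ (- c))%:E <=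
   (A * (t `^ (1 - b) / (1 - b)) + B * t + D * (t `^ (1 - c) / (1 - c)))%:E)%E.
Proof.
move=> A0 B0 D0 b1 c1 t0.
pose F s := A * (s `^ (1 - b) / (1 - b)) + B * s - D * ((t - s) `^ (1 - c) / (1 - c)).
have dF (s : R) : 0 < s < t -> is_derive s (1 : R) F
    (A * s `^ (- b) + B + D * (t - s) `^ (- c)).
  move=> /andP[s0 st].
  have ts0 : 0 < t - s by rewrite subr_gt0.
  have d1 := @is_derive1_powR R (1 - b) s s0.
  have d2 := @is_derive1_powR R (1 - c) (t - s) ts0.
  have d3 : is_derive s (1 : R) (fun s => t - s) (-1).
    apply: is_derive_eq. by ring.
  have d4 : is_derive s (1 : R) (fun s => (t - s) `^ (1 - c))
      (- ((1 - c) * (t - s) `^ (1 - c - 1))).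
    have := @is_derive1_comp _ (@powR R ^~ (1 - c)) (fun s => t - s) s _ _ d2 d3.
    by rewrite mulrN1.
  rewrite /F; apply: is_derive_eq; rewrite /GRing.scale/=.
  have -> : 1 - b - 1 = - b by ring.
  have -> : 1 - c - 1 = - c by ring.
  by field; rewrite !subr_eq0 !gt_eqF.
have dc (G : R -> R) x l : is_derive x (1 : R) G l -> {for x, continuous G}.
  by move=> [+ _]; move/derivable1_diffP; exact: differentiable_continuous.
apply: (integral_itv_le t0 _ _ dF) => [s st|s /andP[s0 st]|x e x0 xe et].
- by rewrite !addr_ge0// mulr_ge0// powR_ge0.
- have ts0 : 0 < t - s by rewrite subr_gt0.
  have c1' : {for s, continuous (@powR R ^~ (- b))}.
    exact: dc (@is_derive1_powR R (- b) s s0).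
  have c2' : {for s, continuous (fun s => (t - s) `^ (- c))}.
    apply: (@continuous_comp _ _ _ (fun s => t - s) (@powR R ^~ (- c))).
      by apply: continuousB; [exact: cst_continuous|exact: cvg_id].
    exact: dc (@is_derive1_powR R (- c) (t - s) ts0).
  apply: continuousD; first apply: continuousD.
  + by apply: continuousM => //; exact: cst_continuous.
  + exact: cst_continuous.
  + by apply: continuousM => //; exact: cst_continuous.
- have b1' : 0 < 1 - b by rewrite subr_gt0.
  have c1' : 0 < 1 - c by rewrite subr_gt0.
  have le1 : A * (e `^ (1 - b) / (1 - b)) <= A * (t `^ (1 - b) / (1 - b)).
    rewrite ler_wpM2l// ler_pM2r ?invr_gt0// ge0_ler_powR ?nnegrE; lra.
  have le2 : 0 <= A * (x `^ (1 - b) / (1 - b)).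
    by rewrite mulr_ge0// divr_ge0 ?powR_ge0// ltW.
  have le3 : D * ((t - x) `^ (1 - c) / (1 - c)) <= D * (t `^ (1 - c) / (1 - c)).
    rewrite ler_wpM2l// ler_pM2r ?invr_gt0// ge0_ler_powR ?nnegrE; lra.
  have le4 : 0 <= D * ((t - e) `^ (1 - c) / (1 - c)).
    by rewrite mulr_ge0// divr_ge0 ?powR_ge0// ltW.
  have le5 : B * e <= B * t by rewrite ler_wpM2l// ltW.
  have le6 : 0 <= B * x by rewrite mulr_ge0// ltW.
  by rewrite /F; lra.
Qed.

(** * The heat kernel: total mass and sup bound *)

Lemma integral_lebesgueRnS (R : realType) (n : nat)
    (F : euclidean R n.+1 -> \bar R) :
  measurable_fun setT F -> (forall x, (0 <= F x)%E) ->
  (\int[lebesgueRn R n.+1]_x F x =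
   \int[@lebesgue_measure R]_a \int[lebesgueRn R n]_y F (tcons (a, y)))%E.
Proof.
move=> mF F0.
have mFt : measurable_fun setT (F \o @tcons R n).
  by apply: measurableT_comp => //; exact: measurable_tcons.
transitivity (\int[(@lebesgue_measure R \x lebesgueRn R n)%E]_z (F \o @tcons R n) z)%E.
  rewrite -[in RHS](preimage_setT (@tcons R n)).
  by rewrite -(ge0_integral_pushforward (@measurable_tcons R n)).
by apply: fubini_tonelli1 => // z; exact: F0.
Qed.

Lemma tnth_tcons0 (R : realType) (n : nat) (p : R * euclidean R n) :
  tnth (tcons p) ord0 = p.1.
Proof. by []. Qed.

Lemma tnth_tconsS (R : realType) (n : nat) (p : R * euclidean R n) (i : 'I_n) :
  tnth (tcons p) (lift ord0 i) = tnth p.2 i.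
Proof. by case: p => a y /=; rewrite tnthS. Qed.

(** Tonelli splits off one coordinate at a time. In dimension 0 the measure is the Dirac mass at the
    empty tuple and the empty product is 1. *)
Lemma integral_prod_normal_pdf (R : realType) (n : nat) (m : 'I_n -> R) (s : R) :
  (\int[lebesgueRn R n]_y (\prod_(i < n) normal_pdf (m i) s (tnth y i))%:E = 1)%E.
Proof.
have mprod k (m' : 'I_k -> R) : measurable_fun setT
    (fun y : euclidean R k => \prod_(i < k) normal_pdf (m' i) s (tnth y i)).
  apply: measurable_prod => i _.
  apply: (measurableT_comp (measurable_normal_pdf _ _)).
  exact: measurable_tnth.
elim: n m => [|n IHn] m.
  under eq_integral do rewrite big_ord0.
  rewrite integral_cst//= mul1e; exact: diracT.
rewrite integral_lebesgueRnS; last 2 first.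
- by apply/measurable_EFinP; exact: mprod.
- by move=> x; rewrite lee_fin prodr_ge0// => i _; exact: normal_pdf_ge0.
rewrite -[RHS](@integral_normal_pdf R (m ord0) s); apply: eq_integral => a _.
under eq_integral.
  move=> y _; rewrite big_ord_recl tnth_tcons0 /=.
  under eq_bigr do rewrite tnth_tconsS /=.
  rewrite EFinM; over.
rewrite ge0_integralZl//.
- by rewrite IHn mule1.
- by apply/measurable_EFinP; exact: mprod.
- by move=> y _; rewrite lee_fin prodr_ge0// => i _; exact: normal_pdf_ge0.
- by rewrite lee_fin normal_pdf_ge0.
Qed.

Section heat_kernel_bounds.
Context {R : realType} {n : nat}.
Local Notation E := (euclidean R n).
Local Notation mu := (lebesgueRn R n).

Lemma enorm_sqr (x : E) : enorm x ^+ 2 = \sum_(i < n) tnth x i ^+ 2.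
Proof. by rewrite /enorm sqr_sqrtr// sumr_ge0// => i _; exact: sqr_ge0. Qed.

Lemma measurable_heat_kernel_esub (t : R) (x : E) :
  measurable_fun setT (fun y : E => heat_kernel t (esub x y)).
Proof.
apply: measurable_funM => //; apply: measurableT_comp => //.
apply: measurableT_comp => //; apply: measurable_funM => //.
under eq_fun do rewrite enorm_sqr.
apply: measurable_sum => i; apply: measurable_funX.
rewrite /esub; under eq_fun do rewrite tnth_mktuple.
by apply: measurable_funB => //; exact: measurable_tnth.
Qed.

Lemma heat_kernel_ge0 (t : R) (x : E) : 0 <= heat_kernel t x.
Proof. by rewrite mulr_ge0 ?powR_ge0 ?expR_ge0. Qed.

Lemma heat_kernel_le (t : R) (x : E) : 0 < t ->
  heat_kernel t x <= t `^ (- (n%:R / 2)).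
Proof.
move=> t0; rewrite /heat_kernel -[leRHS]mulr1 ler_pM ?powR_ge0 ?expR_ge0//.
  have t4 : t <= 4 * pi * t.
    by apply: ler_peMl; [exact: ltW|have := pi_ge2 R; lra].
  rewrite !powRN lef_pV2 ?posrE ?powR_gt0 ?mulr_gt0 ?pi_gt0//.
  have tge0 := ltW t0.
  by rewrite ge0_ler_powR ?nnegrE ?divr_ge0// (le_trans tge0).
rewrite expR_le1 oppr_le0 divr_ge0 ?sqr_ge0//; lra.
Qed.

Lemma integral_heat_kernel (t : R) (x : E) : 0 < t ->
  (\int[mu]_y (heat_kernel t (esub x y))%:E = 1)%E.
Proof.
(* As a function of [y], the kernel is a product of normal densities with means [tnth x i] and
   common variance [2 * t]. *)
move=> t0; rewrite -(integral_prod_normal_pdf (tnth x) (Num.sqrt (2 * t))).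
have st0 : Num.sqrt (2 * t) != 0 by rewrite gt_eqF// sqrtr_gt0 mulr_gt0.
have sqE : Num.sqrt (2 * t) ^+ 2 = 2 * t by rewrite sqr_sqrtr// ltW// mulr_gt0.
apply: eq_integral => y _; congr EFin.
under [RHS]eq_bigr do rewrite normal_pdfE// /normal_peak /normal_fun sqE.
rewrite big_split/= prodr_const card_ord; congr (_ * _).
  rewrite powRN exprVn; congr (_^-1).
  have -> : 2 * t * pi *+ 2 = 4 * pi * t :> R by rewrite -mulr_natr; ring.
  have p0 : 0 <= 4 * pi * t :> R by rewrite ltW// !mulr_gt0// pi_gt0.
  rewrite -powR12_sqrt// -powR_mulrn ?powR_ge0// -powRrM.
  by rewrite [2^-1 * _]mulrC.
rewrite -expR_sum; congr expR.
rewrite enorm_sqr -mulNr -sumrN mulr_suml; apply: eq_bigr => i _.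
rewrite tnth_mktuple; congr (- _ / _); last by rewrite -mulr_natr; ring.
by rewrite -sqrrN opprB.
Qed.

End heat_kernel_bounds.

(** * Pointwise bounds for the heat semigroup *)

Section heat_bounds.
Context {R : realType} {n : nat}.
Local Notation E := (euclidean R n).
Local Notation mu := (lebesgueRn R n).

Lemma heat_le_abs (t : R) (g : E -> R) (x : E) :
  (heat t g x <= \int[mu]_y (heat_kernel t (esub x y) * `|g y|)%:E)%E.
Proof.
apply: le_integral_nnfun => y _; rewrite lee_fin.
  by rewrite ler_wpM2l ?heat_kernel_ge0// ler_norm.
by rewrite mulr_ge0 ?heat_kernel_ge0.
Qed.

(* Splitting |g| at the height l = (t^(-n/2) K)^(1/r), where both parts
   contribute at most l, replaces Hoelder's inequality. *)
Lemma heat_le_Lr (t r K : R) (g : E -> R) (x : E) :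
  0 < t -> 1 <= r -> 0 < K -> measurable_fun setT g ->
  (\int[mu]_y (`|g y| `^ r)%:E <= K%:E)%E ->
  (heat t g x <= (2 * (t `^ (- (n%:R / 2)) * K) `^ r^-1)%:E)%E.
Proof.
move=> t0 r1 K0 mg gK.
have r0 : 0 < r by lra.
set T := t `^ (- (n%:R / 2)).
have T0 : 0 < T by exact: powR_gt0.
have TK0 : 0 < T * K by rewrite mulr_gt0.
set l := (T * K) `^ r^-1.
have l0 : 0 < l by rewrite powR_gt0.
have lr : l `^ r = T * K.
  by rewrite /l -powRrM mulVf ?gt_eqF// powRr1// ltW.
have lr1 : l `^ (1 - r) * (T * K) = l.
  rewrite -lr -powRD; last by apply/implyP => _; rewrite gt_eqF.
  by rewrite subrK powRr1// ltW.
have gl y : `|g y| <= l + l `^ (1 - r) * `|g y| `^ r.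
  have [gyl|lgy] := leP `|g y| l.
    by rewrite (le_trans gyl)// lerDl mulr_ge0 ?powR_ge0.
  have g0 : 0 < `|g y| by exact: lt_trans lgy.
  apply: (@le_trans _ _ (l `^ (1 - r) * `|g y| `^ r)); last first.
    by rewrite lerDr ltW.
  have gE : `|g y| = `|g y| `^ (1 - r) * `|g y| `^ r.
    rewrite -powRD; first by rewrite subrK powRr1.
    by apply/implyP => _; rewrite gt_eqF.
  rewrite {1}gE ler_pM2r ?powR_gt0//.
  have -> : 1 - r = - (r - 1) by ring.
  have r1' : 0 <= r - 1 by rewrite subr_ge0.
  have lgy' := ltW lgy; have l0' := ltW l0.
  by rewrite !powRN lef_pV2 ?posrE ?powR_gt0// ge0_ler_powR ?nnegrE.
have mG := @measurable_heat_kernel_esub R n t x.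
have mgr : measurable_fun setT (fun y => `|g y| `^ r).
  apply: (measurableT_comp (measurable_powR r)).
  exact: measurableT_comp.
have c0 : 0 <= l `^ (1 - r) * T by rewrite mulr_ge0 ?powR_ge0.
apply: le_trans (heat_le_abs t g x) _.
apply: (@le_trans _ _ (\int[mu]_y ((l%:E * (heat_kernel t (esub x y))%:E) +
    ((l `^ (1 - r) * T)%:E * (`|g y| `^ r)%:E)))%E).
  apply: le_integral_nnfun => y _; rewrite -!EFinM -EFinD lee_fin.
    apply: le_trans (ler_wpM2l (heat_kernel_ge0 _ _) (gl y)) _.
    rewrite mulrDr [_ * l]mulrC lerD2l mulrCA -[leRHS]mulrA.
    rewrite ler_wpM2l ?powR_ge0// ler_wpM2r ?powR_ge0//.
    exact: heat_kernel_le.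
  by rewrite addr_ge0// mulr_ge0 ?heat_kernel_ge0 ?powR_ge0// ltW.
have EG : (\int[mu]_y (l%:E * (heat_kernel t (esub x y))%:E) = l%:E)%E.
  rewrite ge0_integralZl//.
  - by rewrite integral_heat_kernel// mule1.
  - exact/measurable_EFinP.
  - by move=> y _; rewrite lee_fin heat_kernel_ge0.
  - by rewrite lee_fin ltW.
have Eg : (\int[mu]_y ((l `^ (1 - r) * T)%:E * (`|g y| `^ r)%:E) <= l%:E)%E.
  rewrite ge0_integralZl//.
  - apply: (@le_trans _ _ ((l `^ (1 - r) * T)%:E * K%:E)%E).
      by rewrite lee_wpmul2l// lee_fin.
    by rewrite -EFinM lee_fin -mulrA lr1.
  - exact/measurable_EFinP.
rewrite ge0_integralD//.
- by rewrite EG mulrDl mul1r EFinD leeD2l.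
- by move=> y _; rewrite mule_ge0 ?lee_fin ?heat_kernel_ge0// ltW.
- by apply: emeasurable_funM => //; apply/measurable_EFinP.
- by move=> y _; rewrite mule_ge0 ?lee_fin ?powR_ge0.
- by apply: emeasurable_funM => //; apply/measurable_EFinP.
Qed.

Lemma heat_le_Loo (t M : R) (g : E -> R) (x : E) :
  0 < t -> 0 <= M -> measurable_fun setT g ->
  {ae mu, forall y, `|g y| <= M} -> (heat t g x <= M%:E)%E.
Proof.
move=> t0 M0 mg gM.
have mG := @measurable_heat_kernel_esub R n t x.
apply: le_trans (heat_le_abs t g x) _.
apply: (@le_trans _ _ (\int[mu]_y (M%:E * (heat_kernel t (esub x y))%:E))%E).
  apply: ae_ge0_le_integral => //.
  - by move=> y _; rewrite lee_fin mulr_ge0 ?heat_kernel_ge0.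
  - by apply/measurable_EFinP; apply: measurable_funM => //; exact: measurableT_comp.
  - by move=> y _; rewrite mule_ge0 ?lee_fin ?heat_kernel_ge0.
  - by apply: emeasurable_funM => //; apply/measurable_EFinP.
  - apply: filterS gM => y gyM _.
    by rewrite -EFinM lee_fin mulrC ler_wpM2r ?heat_kernel_ge0.
rewrite ge0_integralZl//; first by rewrite integral_heat_kernel// mule1.
- by apply/measurable_EFinP.
- by move=> y _; rewrite lee_fin heat_kernel_ge0.
Qed.

End heat_bounds.

(** * Exponential moments from the Luxemburg norm *)

(** For [a > 0] this is [y <= expR y] at [y = z / (4 * a)], raised to the power [a]. *)
Lemma powR_le_expR (R : realType) (a z : R) :
  0 <= a -> 0 <= z -> z `^ a <= (4 * a) `^ a * expR (z / 4).
Proof.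
rewrite le_eqVlt => /orP[/eqP <- z0|a0 z0].
  by rewrite !powRr0 mul1r -expR0 ler_expR divr_ge0.
have a40 : 0 < 4 * a by rewrite mulr_gt0.
have -> : expR (z / 4) = expR (z / (4 * a)) `^ a.
  by rewrite -expRM; congr expR; field; rewrite gt_eqF.
rewrite -powRM ?expR_ge0 ?(ltW a40)//.
have za : z <= 4 * a * expR (z / (4 * a)).
  have zE : z = 4 * a * (z / (4 * a)) by field; rewrite gt_eqF.
  rewrite [leLHS]zE ler_pM2l//.
  by have := @expR_ge1Dx R (z / (4 * a)); lra.
by rewrite ge0_ler_powR ?nnegrE ?(ltW a0)// (le_trans z0 za).
Qed.

(** With [e = expR (z / 2) >= 1 + z / 2], the left side is at most [2 * (e - 1) * e]. Keeping the
    factor [z] is what allows a right side vanishing at 0, as the Young function does. *)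
Lemma mul_expR_half_le (R : realType) (z : R) :
  0 <= z -> z * expR (z / 2) <= 2 * (expR z - 1).
Proof.
move=> z0; have zE : expR z = expR (z / 2) * expR (z / 2).
  by rewrite -expRD; congr expR; field.
have := @expR_ge1Dx R (z / 2); rewrite zE.
set e := expR (z / 2) => e1; nra.
Qed.

Lemma powR_gauss_le (R : realType) (p m l w : R) :
  2 <= p -> 0 <= m -> 0 < l -> 4 * m * l ^+ 2 <= 1 -> 0 <= w ->
  w `^ p * expR (m * w ^+ 2) <=
  2 * (4 * (p / 2 - 1)) `^ (p / 2 - 1) * l `^ p * (expR ((w / l) ^+ 2) - 1).
Proof.
move=> p2 m0 l0 ml w0.
set a := p / 2 - 1; have a0 : 0 <= a by rewrite /a; lra.
set z := (w / l) ^+ 2; have z0 : 0 <= z by exact: sqr_ge0.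
have wl0 : 0 <= w / l by rewrite divr_ge0// ltW.
have wE : w = l * (w / l) by field; rewrite gt_eqF.
have wp : w `^ p = l `^ p * (z * z `^ a).
  rewrite {1}wE powRM// ?(ltW l0)//; congr (_ * _).
  rewrite mulr_powRB1//; last by lra.
  by rewrite /z -powR_mulrn// -powRrM; congr (_ `^ _); field.
have mw : m * w ^+ 2 <= z / 4.
  have -> : m * w ^+ 2 = m * l ^+ 2 * z by rewrite {1}wE exprMn mulrA.
  by nra.
have k1 := powR_le_expR a0 z0.
have k2 := mul_expR_half_le z0.
have e2 : expR (z / 2) = expR (z / 4) * expR (z / 4).
  by rewrite -expRD; congr expR; field.
have k3 : expR (m * w ^+ 2) <= expR (z / 4) by rewrite ler_expR.
have A0 := powR_ge0 (4 * a) a.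
rewrite wp; set A := (4 * a) `^ a in k1 A0 *.
have k4 : z `^ a * expR (m * w ^+ 2) <= A * expR (z / 4) * expR (z / 4).
  by rewrite ler_pM ?powR_ge0 ?expR_ge0.
have k5 := ler_wpM2l z0 k4.
have k6 := ler_wpM2l A0 k2; rewrite e2 in k6.
have lp0 := powR_ge0 l p; set L := l `^ p in lp0 *.
have -> : L * (z * z `^ a) * expR (m * w ^+ 2) =
    L * (z * (z `^ a * expR (m * w ^+ 2))) by rewrite !mulrA.
have -> : 2 * A * L * (expR z - 1) = L * (A * (2 * (expR z - 1))) by ring.
apply: ler_wpM2l => //; apply: le_trans k5 _; apply: le_trans k6.
by rewrite le_eqVlt; apply/orP; left; apply/eqP; ring.
Qed.

Section modular_bounds.
Context {R : realType} {n : nat}.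
Local Notation E := (euclidean R n).
Local Notation mu := (lebesgueRn R n).

(** Some admissible scale lies below [c], and the modular does not increase with the scale. A strict
    inequality avoids asking whether the infimum is attained. *)
Lemma modular_le1 (c : R) (g : E -> R) :
  (expL2_norm g < c%:E)%E -> 0 < c /\ (modular young_exp2 c g <= 1)%E.
Proof.
move=> /ereal_inf_lt[_ [l [l0 gl] <-]]; rewrite lte_fin => lc.
have c0 := lt_trans l0 lc; split => //.
apply: le_trans gl; apply: le_integral_nnfun => x _; rewrite /young_exp2 lee_fin.
  rewrite lerD2r ler_expR ler_sqr ?nnegrE ?divr_ge0 ?(ltW c0) ?(ltW l0)//.
  by rewrite ler_wpM2l// lef_pV2 ?posrE// ltW.
by rewrite subr_ge0 -expR0 ler_expR sqr_ge0.
Qed.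

Lemma measurable_young_exp2 (c : R) (g : E -> R) : measurable_fun setT g ->
  measurable_fun setT (fun x => expR ((`|g x| / c) ^+ 2) - 1).
Proof.
move=> mg; apply: measurable_funB => //; apply: measurableT_comp => //.
apply: measurable_funX; apply: measurable_funM => //; exact: measurableT_comp.
Qed.

Lemma integral_le_modular (c C : R) (g h : E -> R) :
  measurable_fun setT g -> (modular young_exp2 c g <= 1)%E -> 0 <= C ->
  (forall x, h x <= C * (expR ((`|g x| / c) ^+ 2) - 1)) ->
  (\int[mu]_x (h x)%:E <= C%:E)%E.
Proof.
move=> mg gc C0 hC.
have e0 x : 0 <= expR ((`|g x| / c) ^+ 2) - 1.
  by rewrite subr_ge0 -expR0 ler_expR sqr_ge0.
apply: (@le_trans _ _
  (\int[mu]_x (C%:E * (expR ((`|g x| / c) ^+ 2) - 1)%:E))%E).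
  by apply: le_integral_nnfun => x _; rewrite -EFinM lee_fin// mulr_ge0.
rewrite ge0_integralZl//.
- by rewrite -[leRHS]mule1 lee_wpmul2l// lee_fin.
- by apply/measurable_EFinP; exact: measurable_young_exp2.
- by move=> x _; rewrite lee_fin.
Qed.

Lemma integral_gauss_le (p m l : R) (g : E -> R) :
  measurable_fun setT g -> 2 <= p -> 0 <= m -> 0 < l -> 4 * m * l ^+ 2 <= 1 ->
  (modular young_exp2 l g <= 1)%E ->
  (\int[mu]_x (`|g x| `^ p * expR (m * g x ^+ 2))%:E <=
   (2 * (4 * (p / 2 - 1)) `^ (p / 2 - 1) * l `^ p)%:E)%E.
Proof.
move=> mg p2 m0 l0 ml gl.
apply: (integral_le_modular mg gl) => [|x].
  by rewrite !mulr_ge0 ?powR_ge0.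
by rewrite -(real_normK (num_real (g x))) powR_gauss_le.
Qed.

Lemma integral_sqr_le (l : R) (g : E -> R) :
  measurable_fun setT g -> 0 < l -> (modular young_exp2 l g <= 1)%E ->
  (\int[mu]_x (`|g x| ^+ 2)%:E <= (l ^+ 2)%:E)%E.
Proof.
move=> mg l0 gl; apply: (integral_le_modular mg gl) => [|x]; first exact: sqr_ge0.
rewrite [X in X ^+ 2 <= _](_ : _ = l * (`|g x| / l)); last first.
  by field; rewrite gt_eqF.
rewrite exprMn ler_pM2l ?exprn_gt0//.
by have := @expR_ge1Dx R ((`|g x| / l) ^+ 2); lra.
Qed.

End modular_bounds.

(** * The heat semigroup applied to the data and to the nonlinearity *)

Section nonlinearity_bounds.
Context {R : realType} {n : nat}.
Local Notation E := (euclidean R n).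
Local Notation mu := (lebesgueRn R n).
Hypothesis n_gt0 : (0 < n)%N.

Local Notation N := (n%:R : R).
Local Notation p := (1 + 4 / N).

Let N0 : 0 < N. Proof. by rewrite ltr0n. Qed.
Let N1 : 1 <= N. Proof. by rewrite ler1n. Qed.
Let Nneq0 : N != 0. Proof. by rewrite gt_eqF. Qed.

Lemma norm_nonlinearity (v : R) :
  `|nonlinearity n v| = `|v| `^ p * expR (v ^+ 2).
Proof.
have p0 : 0 < p by rewrite ltr_wpDr// divr_ge0// ltW.
rewrite /nonlinearity !normrM (ger0_norm (powR_ge0 _ _)).
rewrite (ger0_norm (expR_ge0 _)); congr (_ * _).
by rewrite -(mulr_powRB1 (normr_ge0 v) p0) mulrC; congr (_ * _ `^ _); ring.
Qed.

Lemma measurable_nonlinearity (v : E -> R) : measurable_fun setT v ->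
  measurable_fun setT (fun y => nonlinearity n (v y)).
Proof.
move=> mv; apply: measurable_funM; first apply: measurable_funM => //.
  apply: (measurableT_comp (measurable_powR _)); exact: measurableT_comp.
by apply: measurableT_comp => //; exact: measurable_funX.
Qed.

Lemma powR_norm_nonlinearity (v r : R) :
  `|nonlinearity n v| `^ r = `|v| `^ (p * r) * expR (r * v ^+ 2).
Proof.
rewrite norm_nonlinearity powRM ?powR_ge0 ?expR_ge0// -powRrM.
by rewrite [r * _]mulrC (expRM (v ^+ 2)).
Qed.

Lemma heat_data_le (t d : R) (phi : E -> R) (x : E) :
  0 < t -> 0 < d -> measurable_fun setT phi ->
  (modular young_exp2 d phi <= 1)%E ->
  (heat t phi x <= (2 * d * t `^ (- (N / 4)))%:E)%E.
Proof.
move=> t0 d0 mphi phi1.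
have d20 : 0 < d ^+ 2 by rewrite exprn_gt0.
have := @heat_le_Lr R n t 2 (d ^+ 2) phi x t0 _ d20 mphi.
have -> : (2 * (t `^ (- (N / 2)) * d ^+ 2) `^ 2^-1) = 2 * d * t `^ (- (N / 4)).
  rewrite powRM ?powR_ge0 ?ltW// -powRrM powR12_sqrt ?ltW// sqrtr_sqr gtr0_norm//.
  have -> : - (N / 2) / 2 = - (N / 4) by field.
  by ring.
apply; first by rewrite ler1n.
under eq_integral do rewrite powR_mulrn//.
exact: integral_sqr_le.
Qed.

(** The exponent [r = N] gives the integrable singularity of order 1/2, and [p * N = N + 4] turns
    the moment bound into the power [p] of [d]. The moment bound at weight [N] and scale [2 * d]
    needs [16 * N * d ^+ 2 <= 1]. *)
Lemma heat_nonlinearity_Ln : exists2 c : R, 0 < c &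
  forall (d tau : R) (v : E -> R) (x : E),
  0 < d -> 16 * (N + 2) * d ^+ 2 <= 1 -> 0 < tau -> measurable_fun setT v ->
  (modular young_exp2 (2 * d) v <= 1)%E ->
  (heat tau (fun y => nonlinearity n (v y)) x <=
   (c * d `^ p * tau `^ (- 2^-1))%:E)%E.
Proof.
have n1 := N1; have n0 := N0.
pose a := (N + 4) / 2 - 1.
have a0 : 0 < a by rewrite /a; lra.
pose C := 2 * (4 * a) `^ a.
have C0 : 0 < C by rewrite mulr_gt0// powR_gt0// mulr_gt0.
have C20 : 0 < C * 2 `^ (N + 4) by rewrite mulr_gt0// powR_gt0.
exists (2 * (C * 2 `^ (N + 4)) `^ N^-1); first by rewrite mulr_gt0// powR_gt0.
move=> d tau v x d0 dn tau0 mv vd.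
have K0 : 0 < C * (2 * d) `^ (N + 4) by rewrite mulr_gt0// powR_gt0// mulr_gt0.
have := @heat_le_Lr R n tau N _ _ x tau0 N1 K0 (measurable_nonlinearity mv).
have -> : 2 * (tau `^ (- (N / 2)) * (C * (2 * d) `^ (N + 4))) `^ N^-1 =
    2 * (C * 2 `^ (N + 4)) `^ N^-1 * d `^ p * tau `^ (- 2^-1).
  have d0' := ltW d0.
  have E1 : ((C * 2 `^ (N + 4)) * d `^ (N + 4)) `^ N^-1 =
      (C * 2 `^ (N + 4)) `^ N^-1 * d `^ p.
    rewrite powRM ?powR_ge0 ?(ltW C20)// -powRrM; congr (_ * _ `^ _).
    by field.
  have KE0 : 0 <= C * 2 `^ (N + 4) * d `^ (N + 4).
    by rewrite mulr_ge0 ?powR_ge0 ?(ltW C20).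
  rewrite (@powRM _ 2 d)// [C * _]mulrA powRM ?powR_ge0// E1 -powRrM.
  have -> : - (N / 2) * N^-1 = - 2^-1 by field.
  by ring.
apply.
under eq_integral do rewrite powR_norm_nonlinearity.
have -> : p * N = N + 4 by field.
apply: integral_gauss_le => //; [lra|exact: mulr_gt0|].
by nra.
Qed.

Lemma heat_nonlinearity_Lr : exists2 c : R, 0 < c &
  forall (d s tau : R) (v : E -> R) (x : E),
  0 < d -> 16 * (N + 2) * d ^+ 2 <= 1 -> 0 < s -> 0 < tau ->
  measurable_fun setT v ->
  (modular young_exp2 (2 * d) v <= 1)%E ->
  {ae mu, forall y, `|v y| <= 3 * d * s `^ (- (N / 4))} ->
  (heat tau (fun y => nonlinearity n (v y)) x <=
   (c * d `^ p * tau `^ (- (N / 2 * ((N + 4) / (2 * N + 4)))) *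
      s `^ (- ((N + 4) / (2 * N + 4))))%:E)%E.
Proof.
have n1 := N1; have n0 := N0.
pose r := (2 * N + 4) / (N + 4).
have r1 : 1 <= r by rewrite /r ler_pdivlMr; lra.
have r2 : r <= 2 by rewrite /r ler_pdivrMr; lra.
have rE : r^-1 = (N + 4) / (2 * N + 4) by rewrite /r invf_div.
have pr : p * r = 4 / N + 2.
  by rewrite /r; field; rewrite Nneq0/= gt_eqF//; lra.
have p40 : 0 <= 4 / N by rewrite divr_ge0 ?(ltW N0).
exists (2 * (3 `^ (4 / N) * 8) `^ r^-1).
  by rewrite mulr_gt0// powR_gt0// mulr_gt0// powR_gt0.
move=> d s tau v x d0 dn s0 tau0 mv vd vM.
have d0' := ltW d0.
set M := 3 * d * s `^ (- (N / 4)) in vM.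
have M0 : 0 < M by rewrite !mulr_gt0 ?powR_gt0.
have K0 : 0 < M `^ (4 / N) * (2 * (2 * d) ^+ 2).
  by rewrite mulr_gt0 ?powR_gt0// mulr_gt0// exprn_gt0// mulr_gt0.
have := @heat_le_Lr R n tau r _ _ x tau0 r1 K0 (measurable_nonlinearity mv).
have KE : M `^ (4 / N) * (2 * (2 * d) ^+ 2) =
    (3 `^ (4 / N) * 8) * (d `^ (4 / N + 2) * s `^ (- 1)).
  rewrite /M !powRM ?mulr_ge0 ?powR_ge0// -powRrM powRD; last first.
    by apply/implyP => _; rewrite gt_eqF.
  have -> : - (N / 4) * (4 / N) = -1 by field.
  by rewrite powR_mulrn//; ring.
rewrite KE.
have -> : 2 * (tau `^ (- (N / 2)) * (3 `^ (4 / N) * 8 *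
      (d `^ (4 / N + 2) * s `^ (- 1)))) `^ r^-1 =
    2 * (3 `^ (4 / N) * 8) `^ r^-1 * d `^ p * tau `^ (- (N / 2 * r^-1)) *
      s `^ (- r^-1).
  have E1 : (d `^ (4 / N + 2)) `^ r^-1 = d `^ p.
    rewrite -powRrM -pr -mulrA mulfV ?mulr1// gt_eqF//; lra.
  have ds0 : 0 <= d `^ (4 / N + 2) * s `^ (- 1) by rewrite mulr_ge0 ?powR_ge0.
  have c0 : 0 <= 3 `^ (4 / N) * 8 by rewrite mulr_ge0 ?powR_ge0.
  have cds0 := mulr_ge0 c0 ds0.
  rewrite powRM ?powR_ge0// (powRM _ c0 ds0).
  rewrite (powRM _ (powR_ge0 d _) (powR_ge0 s _)).
  rewrite E1 -!powRrM mulN1r mulNr.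
  by ring.
rewrite rE; apply.
have mf := measurable_nonlinearity mv.
have mv2 : measurable_fun setT (fun y => `|v y| `^ 2 * expR (r * v y ^+ 2)).
  apply: measurable_funM.
    by apply: (measurableT_comp (measurable_powR _)); exact: measurableT_comp.
  apply: measurableT_comp => //; apply: measurable_funM => //.
  exact: measurable_funX.
apply: (@le_trans _ _ (\int[mu]_y ((M `^ (4 / N))%:E *
    (`|v y| `^ 2 * expR (r * v y ^+ 2))%:E))%E).
  apply: ae_ge0_le_integral => //.
  - apply/measurable_EFinP; apply: (measurableT_comp (measurable_powR _)).
    exact: measurableT_comp.
  - by move=> y _; rewrite -EFinM lee_fin !mulr_ge0 ?powR_ge0 ?expR_ge0.
  - by apply: emeasurable_funM => //; apply/measurable_EFinP.
  - apply: filterS vM => y vyM _; rewrite -EFinM lee_fin powR_norm_nonlinearity pr.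
    rewrite powRD; last by apply/implyP; rewrite gt_eqF// ltr_wpDl.
    rewrite -mulrA ler_wpM2r ?mulr_ge0 ?powR_ge0 ?expR_ge0//.
    by rewrite ge0_ler_powR ?nnegrE ?(ltW M0).
rewrite ge0_integralZl//; last 2 first.
- exact/measurable_EFinP.
- by rewrite lee_fin powR_ge0.
rewrite -KE EFinM lee_wpmul2l ?lee_fin ?powR_ge0//.
have -> : 2 * (2 * d) ^+ 2 =
    2 * (4 * (2 / 2 - 1)) `^ (2 / 2 - 1) * (2 * d) `^ 2 :> R.
  by rewrite divff// subrr powRr0 mulr1 powR_mulrn// mulr_ge0.
apply: integral_gauss_le => //; [lra|exact: mulr_gt0|].
by nra.
Qed.

Lemma heat_nonlinearity_Loo : exists2 c : R, 0 < c &
  forall (d s tau : R) (v : E -> R) (x : E),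
  0 < d <= 1 -> 1 <= s -> 0 < tau ->
  measurable_fun setT v ->
  {ae mu, forall y, `|v y| <= 3 * d * s `^ (- (N / 4))} ->
  (heat tau (fun y => nonlinearity n (v y)) x <=
   (c * d `^ p * s `^ (- (N / 4 + 1)))%:E)%E.
Proof.
have p0 : 0 <= p by rewrite addr_ge0// divr_ge0// ltW.
exists (3 `^ p * expR 9); first by rewrite mulr_gt0 ?powR_gt0 ?expR_gt0.
move=> d s tau v x /andP[d0 d1] s1 tau0 mv vM.
have s0 : 0 < s by lra.
set M := 3 * d * s `^ (- (N / 4)) in vM.
have M0 : 0 <= M by rewrite !mulr_ge0 ?powR_ge0// ltW.
have M3 : M <= 3.
  have : s `^ (- (N / 4)) <= 1.
    have N40 : - (N / 4) <= 0 by have := N0; lra.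
    by have := ler_powR s1 N40; rewrite powRr0.
  by have := powR_ge0 s (- (N / 4)); rewrite /M; nra.
have -> : 3 `^ p * expR 9 * d `^ p * s `^ (- (N / 4 + 1)) = M `^ p * expR 9.
  rewrite /M !powRM ?mulr_ge0 ?powR_ge0 ?(ltW d0)// -powRrM.
  have -> : - (N / 4) * p = - (N / 4 + 1) by field.
  by ring.
apply: heat_le_Loo => //; first by rewrite mulr_ge0 ?powR_ge0 ?expR_ge0.
  exact: measurable_nonlinearity.
apply: filterS vM => y vyM; rewrite norm_nonlinearity.
rewrite ler_pM ?powR_ge0 ?expR_ge0//; first by rewrite ge0_ler_powR ?nnegrE.
rewrite ler_expR -real_normK ?num_real//.
by have := normr_ge0 (v y); nra.
Qed.

End nonlinearity_bounds.

(** * Propagation of the pointwise decay *)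

Section decay.
Context {R : realType} {n : nat}.
Local Notation E := (euclidean R n).
Local Notation mu := (lebesgueRn R n).
Hypothesis n_gt0 : (0 < n)%N.

Local Notation N := (n%:R : R).
Local Notation p := (1 + 4 / N).

Definition duhamel_equation (phi : E -> R) (u : R -> E -> R) (t : R) : Prop :=
  {ae mu, forall x, (u t x)%:E = (heat t phi x +
     \int[@lebesgue_measure R]_(s in `]0%R, t[)
        heat (t - s)%R (fun y => nonlinearity n (u s y)) x)%E}.

(** The constant 3 is 2 from the heat flow of the data plus 1 allotted to the integral term.
    Positivity of [u t] reduces the absolute value to an upper bound, so the integral term is never
    estimated from below. *)
Lemma duhamel_decay (phi : E -> R) (u : R -> E -> R) (d t A B D b c : R) :
  0 < d -> 0 < t -> 0 <= A -> 0 <= B -> 0 <= D -> b < 1 -> c < 1 ->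
  measurable_fun setT phi -> (modular young_exp2 d phi <= 1)%E ->
  duhamel_equation phi u t -> {ae mu, forall x, 0 <= u t x} ->
  (forall s x, 0 < s < t -> (heat (t - s) (fun y => nonlinearity n (u s y)) x <=
    (A * s `^ (- b) + B + D * (t - s) `^ (- c))%:E)%E) ->
  A * (t `^ (1 - b) / (1 - b)) + B * t + D * (t `^ (1 - c) / (1 - c)) <=
    d * t `^ (- (N / 4)) ->
  {ae mu, forall x, `|u t x| <= 3 * d * t `^ (- (N / 4))}.
Proof.
move=> d0 t0 A0 B0 D0 b1 c1 mphi phi1 ut u0 hle Ile.
apply: filterS2 ut u0 => x utx u0x; rewrite ger0_norm// -lee_fin utx.
have -> : 3 * d * t `^ (- (N / 4)) =
  2 * d * t `^ (- (N / 4)) + d * t `^ (- (N / 4)) by ring.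
rewrite EFinD leeD//; first exact: heat_data_le.
apply: le_trans (_ : ((A * (t `^ (1 - b) / (1 - b)) + B * t +
    D * (t `^ (1 - c) / (1 - c)))%:E <= _)%E); last by rewrite lee_fin.
apply: le_trans (integral_singular_le A0 B0 D0 b1 c1 t0).
apply: le_integral_nnfun => s /=; rewrite in_itv/= => st; first exact: hle.
by rewrite lee_fin !addr_ge0// mulr_ge0// powR_ge0.
Qed.

Lemma mild_solution_decay : exists2 eps : R, 0 < eps &
  forall (d : R) (phi : E -> R) (u : R -> E -> R),
  0 < d < eps -> measurable_fun setT phi -> (modular young_exp2 d phi <= 1)%E ->
  (forall t, 0 < t -> measurable_fun setT (u t)) ->
  (forall t, 0 < t -> (modular young_exp2 (2 * d) (u t) <= 1)%E) ->
  (forall t, 0 < t -> duhamel_equation phi u t) ->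
  positive_in_time u ->
  forall t, 0 < t -> {ae mu, forall x, `|u t x| <= 3 * d * t `^ (- (N / 4))}.
Proof.
have N0 : 0 < N by rewrite ltr0n.
have N1 : 1 <= N by rewrite ler1n.
have [c1 c10 heat1] := @heat_nonlinearity_Ln R n n_gt0.
have [c2 c20 heat2] := @heat_nonlinearity_Lr R n n_gt0.
have [c3 c30 heat3] := @heat_nonlinearity_Loo R n n_gt0.
set b := (N + 4) / (2 * N + 4) in heat2.
have b1 : b < 1 by rewrite /b ltr_pdivrMr; lra.
have b0 : 0 < b by rewrite /b divr_gt0; lra.
(* This balance dictates the choice of [r = b^-1]: it makes the kernel factor of order [N / 2 * b]
   times the integral of order [1 - b] equal to the target power [- (N / 4)]. *)
have bE : b * (N / 2 + 1) = N / 4 + 1 by rewrite /b; field; rewrite gt_eqF; lra.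
(* The constant [k1] serves times up to 2; [k2], [k3] and [4 * c1] serve the three time zones for
   later times, with 4 coming from [1 / (1 - 3 / 4)]. *)
pose k1 := 2 * c1 * 2 `^ (2^-1 + N / 4).
pose k2 := c2 * 2 `^ (N / 2 * b) / (1 - b).
pose k3 := c3 * 2 `^ (N / 4 + 1).
have k10 : 0 < k1 by rewrite !mulr_gt0 ?powR_gt0.
have k20 : 0 < k2 by rewrite divr_gt0 ?mulr_gt0 ?powR_gt0 ?subr_gt0.
have k30 : 0 < k3 by rewrite mulr_gt0 ?powR_gt0.
pose M := k1 + k2 + k3 + 4 * c1.
have M0 : 0 < M by rewrite /M; lra.
have N20 : 0 < 4 * (N + 2) by lra.
(* The first bound gives the moment condition and [d <= 1]. The second gives [d]^ (4 / N) * M <=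
   1[, which pays for all constants because]d [^ p] has this factor to spare over [d]. *)
exists (Num.min (4 * (N + 2))^-1 (M^-1 `^ (N / 4))).
  by rewrite lt_min powR_gt0 invr_gt0 ?N20.
move=> d phi u /andP[d0]; rewrite lt_min => /andP[dN dM] mphi phi1 mu_ um ueq upos.
have d0' := ltW d0.
have dN' : 4 * (N + 2) * d < 1 by rewrite mulrC -ltr_pdivlMr// div1r.
have dn : 16 * (N + 2) * d ^+ 2 <= 1 by nra.
have d1 : 0 < d <= 1 by rewrite d0/=; nra.
pose dl := d `^ (4 / N).
have dl0 : 0 <= dl by exact: powR_ge0.
have dlM : dl * M <= 1.
  rewrite -ler_pdivlMr// div1r /dl.
  apply: (@le_trans _ _ ((M^-1 `^ (N / 4)) `^ (4 / N))).
    by rewrite ge0_ler_powR ?nnegrE ?powR_ge0 ?divr_ge0// ltW.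
  rewrite -powRrM (_ : N / 4 * (4 / N) = 1); last by field; rewrite gt_eqF.
  by rewrite powRr1// invr_ge0 ltW.
have dpE : d `^ p = d * dl.
  by rewrite powRD ?powRr1//; apply/implyP => _; rewrite gt_eqF.
have dp0 : 0 <= d `^ p by exact: powR_ge0.
pose P t := {ae mu, forall x, `|u t x| <= 3 * d * t `^ (- (N / 4))}.
have base t : 0 < t -> t <= 2 -> P t.
  move=> t0 t2.
  apply: (@duhamel_decay phi u d t 0 0 (c1 * d `^ p) 0 2^-1) => //.
  - by rewrite mulr_ge0// ltW.
  - lra.
  - exact: ueq.
  - exact: upos.
  - move=> s x /andP[s0 st]; rewrite mul0r !add0r.
    by apply: heat1 => //; rewrite ?subr_gt0//; [exact: mu_|exact: um].
  - rewrite !mul0r !add0r dpE.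
    have -> : t `^ (1 - 2^-1) = t `^ (2^-1 + N / 4) * t `^ (- (N / 4)).
      rewrite -powRD; last by apply/implyP => _; rewrite gt_eqF.
      congr (_ `^ _); lra.
    have t2' : t `^ (2^-1 + N / 4) <= 2 `^ (2^-1 + N / 4).
      by rewrite ge0_ler_powR ?nnegrE ?addr_ge0 ?divr_ge0// ltW.
    have tN := powR_ge0 t (- (N / 4)).
    set X := t `^ (- (N / 4)) in tN *; set Y := t `^ _ in t2' *.
    have -> : c1 * (d * dl) * (Y * X / (1 - 2^-1)) = d * X * (dl * (2 * c1 * Y)).
      by field.
    rewrite -[leRHS]mulr1 ler_wpM2l ?mulr_ge0//.
    apply: le_trans dlM; rewrite ler_wpM2l//.
    have k1Y : 2 * c1 * Y <= k1 by rewrite ler_pM2l// mulr_gt0.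
    by apply: le_trans k1Y _; rewrite /M; lra.
have step T t : 0 < T -> 2 < t <= T ->
  (forall s, 0 < s -> s <= t - T `^ (- (N + 1)) -> P s) -> P t.
  move=> T0 /andP[t2 tT] IH.
  set eta := T `^ (- (N + 1)) in IH.
  have eta0 : 0 < eta by exact: powR_gt0.
  have t0 : 0 < t by lra.
  have th0 : 0 < t / 2 by lra.
  pose A := c2 * d `^ p * (t / 2) `^ (- (N / 2 * b)).
  pose B := c3 * d `^ p * (t / 2) `^ (- (N / 4 + 1)).
  pose D := c1 * d `^ p * eta `^ 4^-1.
  have A0 : 0 <= A by rewrite !mulr_ge0 ?powR_ge0// ltW.
  have B0 : 0 <= B by rewrite !mulr_ge0 ?powR_ge0// ltW.
  have D0 : 0 <= D by rewrite !mulr_ge0 ?powR_ge0// ltW.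
  apply: (@duhamel_decay phi u d t A B D b (3 / 4)) => //.
  - lra.
  - exact: ueq.
  - exact: upos.
  - move=> s x /andP[s0 st].
    have ts0 : 0 < t - s by rewrite subr_gt0.
    have tA : 0 <= A * s `^ (- b) by rewrite mulr_ge0 ?powR_ge0.
    have tD : 0 <= D * (t - s) `^ (- (3 / 4)) by rewrite mulr_ge0 ?powR_ge0.
    have [seta|etas] := leP s (t - eta); last first.
      (* [t - s < eta] trades a factor [(t - s)^(1/4)] for the small [eta^(1/4)]. *)
      apply: le_trans (heat1 d (t - s) (u s) x d0 dn ts0 (mu_ _ s0) (um _ s0)) _.
      rewrite lee_fin.
      suff : c1 * d `^ p * (t - s) `^ (- 2^-1) <= D * (t - s) `^ (- (3 / 4)) by lra.
      have -> : (t - s) `^ (- 2^-1) = (t - s) `^ 4^-1 * (t - s) `^ (- (3 / 4)).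
        rewrite -powRD; last by apply/implyP => _; rewrite gt_eqF.
        congr (_ `^ _); lra.
      rewrite mulrA ler_wpM2r ?powR_ge0// ler_wpM2l ?mulr_ge0 ?(ltW c10)//.
      rewrite ge0_ler_powR ?nnegrE ?(ltW ts0) ?(ltW eta0)//; lra.
    have [sth|ths] := ltP s (t / 2).
      apply: le_trans (heat2 d s (t - s) (u s) x d0 dn s0 ts0 (mu_ _ s0) (um _ s0)
        (IH _ s0 seta)) _.
      rewrite lee_fin.
      suff : c2 * d `^ p * (t - s) `^ (- (N / 2 * b)) * s `^ (- b) <=
        A * s `^ (- b) by lra.
      rewrite ler_wpM2r ?powR_ge0// ler_wpM2l ?mulr_ge0 ?(ltW c20)//.
      rewrite !powRN lef_pV2 ?posrE ?powR_gt0//.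
      rewrite ge0_ler_powR ?nnegrE ?mulr_ge0 ?divr_ge0 ?(ltW b0) ?(ltW ts0) ?(ltW t0)//.
      lra.
    have s1 : 1 <= s by lra.
    apply: le_trans (heat3 d s (t - s) (u s) x d1 s1 ts0 (mu_ _ s0)
      (IH _ s0 seta)) _.
    rewrite lee_fin.
    suff : c3 * d `^ p * s `^ (- (N / 4 + 1)) <= B by lra.
    rewrite ler_wpM2l ?mulr_ge0 ?(ltW c30)//.
    rewrite !powRN lef_pV2 ?posrE ?powR_gt0//.
    by rewrite ge0_ler_powR ?nnegrE ?addr_ge0 ?divr_ge0 ?(ltW s0) ?(ltW t0).
  - have tN := powR_ge0 t (- (N / 4)).
    set X := t `^ (- (N / 4)) in tN *.
    have tne r s : t `^ (r + s) = t `^ r * t `^ s.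
      by rewrite powRD//; apply/implyP => _; rewrite gt_eqF.
    have thE r : (t / 2) `^ (- r) = 2 `^ r * t `^ (- r).
      by rewrite powRM ?invr_ge0 ?(ltW t0)// -powR_inv1// -powRrM mulN1r opprK mulrC.
    have IA : A * (t `^ (1 - b) / (1 - b)) = d * (dl * k2) * X.
      have -> : X = t `^ (- (N / 2 * b)) * t `^ (1 - b).
        rewrite -tne; congr (_ `^ _); lra.
      by rewrite /A dpE thE /k2; ring.
    have IB : B * t = d * (dl * k3) * X.
      have -> : X = t `^ (- (N / 4 + 1)) * t.
        rewrite -[X in _ = _ * X]powRr1 ?(ltW t0)// -tne; congr (_ `^ _); lra.
      by rewrite /B dpE thE /k3; ring.
    have ID : D * (t `^ (1 - 3 / 4) / (1 - 3 / 4)) <= d * (dl * (4 * c1)) * X.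
      have etaX : eta `^ 4^-1 * t `^ (1 - 3 / 4) <= X.
        have -> : X = (t `^ (- (N + 1))) `^ 4^-1 * t `^ (1 - 3 / 4).
          rewrite -powRrM -tne; congr (_ `^ _); lra.
        rewrite ler_wpM2r ?powR_ge0// ge0_ler_powR ?nnegrE ?powR_ge0//.
        rewrite /eta !powRN lef_pV2 ?posrE ?powR_gt0//.
        rewrite ge0_ler_powR ?nnegrE ?addr_ge0 ?(ltW t0) ?(ltW T0)//.
      have -> : D * (t `^ (1 - 3 / 4) / (1 - 3 / 4)) =
        d * (dl * (4 * c1)) * (eta `^ 4^-1 * t `^ (1 - 3 / 4)).
        by rewrite /D dpE; field.
      by rewrite ler_wpM2l// !mulr_ge0// ltW.
    rewrite IA IB; apply: le_trans (lerD (lexx _) ID) _.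
    rewrite -!mulrDl -!mulrDr -[leRHS]mulr1 mulrAC ler_wpM2l ?mulr_ge0//.
    apply: le_trans dlM; rewrite ler_wpM2l// /M; lra.
move=> t t0; pose T := t + 1; have T0 : 0 < T by rewrite /T; lra.
pose eta := T `^ (- (N + 1)); have eta0 : 0 < eta by exact: powR_gt0.
(* Each iteration extends the known range beyond 2 by one [eta], with [T] fixed; finitely many reach
   the given [t]. *)
suff iter k : forall s, 0 < s -> s <= T -> s <= 2 + k%:R * eta -> P s.
  apply: (iter (Num.trunc (t / eta)).+1) => //; first by rewrite /T; lra.
  by have := truncnS_gt (t / eta); rewrite ltr_pdivrMr// => ?; lra.
elim: k => [|k IH] s s0 sT sk; first by apply: base => //; lra.
have [s2|s2] := leP s 2; first exact: base.
apply: (step T) => //; first by rewrite s2.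
move=> r r0 rs; apply: IH => //.
- by move: rs; rewrite -/eta; lra.
- by move: rs sk; rewrite -/eta -natr1; lra.
Qed.

End decay.

(** * Interpolation and passage to the norm of the data *)

Section interpolation.
Context {R : realType} {n : nat}.
Local Notation E := (euclidean R n).
Local Notation mu := (lebesgueRn R n).

(** For finite [q], the sup bound takes [q - 2] powers of [g] and the second moment bound
    [(2 * d) ^+ 2] takes the other two; enlarging [2 * d] to [3 * d] gives a single constant for all
    [q]. *)
Lemma Lnorm_interpolation (q : \bar R) (d X : R) (g : E -> R) :
  (2%:E <= q)%E -> 0 < d -> 0 < X -> measurable_fun setT g ->
  (modular young_exp2 (2 * d) g <= 1)%E ->
  {ae mu, forall x, `|g x| <= 3 * d * X} ->
  (Lnorm mu q (EFin \o g) <= (3 * d * X `^ (1 - 2 * fine q^-1))%:E)%E.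
Proof.
move=> q2 d0 X0 mg gd gM; rewrite unlock; case: q q2 => [q|_|//] /=.
  rewrite lee_fin => q2; have q0 : 0 < q by lra.
  rewrite fine_invr; set M := 3 * d * X in gM.
  have d20 : 0 < 2 * d by rewrite mulr_gt0.
  have M0 : 0 < M by rewrite !mulr_gt0.
  set J := (\int[mu]_x (`|g x| `^ q)%:E)%E.
  change (J `^ q^-1 <= (3 * d * X `^ (1 - 2 * q^-1))%:E)%E.
  have le1 : (J <=
      (M `^ (q - 2) * (2 * d) ^+ 2)%:E)%E.
    apply: (@le_trans _ _
      (\int[mu]_x ((M `^ (q - 2))%:E * (`|g x| ^+ 2)%:E))%E).
      apply: ae_ge0_le_integral => //.
      - apply/measurable_EFinP; apply: (measurableT_comp (measurable_powR _)).
        exact: measurableT_comp.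
      - by move=> x _; rewrite -EFinM lee_fin mulr_ge0 ?powR_ge0.
      - apply: emeasurable_funM => //; apply/measurable_EFinP.
        by apply: measurable_funX; exact: measurableT_comp.
      - apply: filterS gM => x xM _; rewrite -EFinM lee_fin.
        rewrite -powR_mulrn//.
        have -> : `|g x| `^ q = `|g x| `^ (q - 2) * `|g x| `^ 2.
          by rewrite -powRD ?subrK//; apply/implyP; rewrite gt_eqF.
        rewrite ler_wpM2r ?powR_ge0// ge0_ler_powR ?nnegrE ?(ltW M0)//; lra.
    rewrite ge0_integralZl//.
    - rewrite EFinM lee_wpmul2l ?lee_fin ?powR_ge0//.
      exact: integral_sqr_le.
    - apply/measurable_EFinP.
      by apply: measurable_funX; exact: measurableT_comp.
    - by rewrite lee_fin powR_ge0.
  have ge1 : (0 <= J)%E by apply: integral_ge0 => x _; rewrite lee_fin powR_ge0.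
  have JE : J = (fine J)%:E.
    by rewrite fineK// ge0_fin_numE// (le_lt_trans le1)// ltry.
  move: ge1 le1; rewrite JE poweR_EFin !lee_fin => I0 IM.
  set I := fine J in I0 IM *.
  have le2 : M `^ (q - 2) * (2 * d) ^+ 2 <= ((3 * d * X `^ (1 - 2 * q^-1)) `^ q).
    rewrite -powR_mulrn ?(ltW d20)//.
    have -> : (3 * d * X `^ (1 - 2 * q^-1)) `^ q =
        (3 * d) `^ (q - 2) * X `^ (q - 2) * (3 * d) `^ 2.
      rewrite powRM ?powR_ge0 ?mulr_ge0 ?(ltW d0)// -powRrM.
      have -> : (1 - 2 / q) * q = q - 2 by field; rewrite gt_eqF.
      rewrite [RHS]mulrAC -powRD ?subrK//.
      by apply/implyP => _; rewrite gt_eqF// mulr_gt0.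
    rewrite -powRM ?mulr_ge0 ?(ltW d0) ?(ltW X0)// ler_wpM2l ?powR_ge0//.
    rewrite ge0_ler_powR ?nnegrE ?mulr_ge0 ?(ltW d0)//; lra.
  have le3 : I <= (3 * d * X `^ (1 - 2 * q^-1)) `^ q by exact: le_trans le2.
  have Y0 : 0 <= 3 * d * X `^ (1 - 2 * q^-1) by rewrite !mulr_ge0 ?powR_ge0 ?(ltW d0).
  set Y := 3 * d * _ in le3 Y0 *.
  have -> : Y = (Y `^ q) `^ q^-1 by rewrite -powRrM mulfV ?gt_eqF// powRr1.
  by rewrite ge0_ler_powR ?nnegrE ?powR_ge0 ?invr_ge0 ?(ltW q0).
(* For [q = +oo] the inverse is 0 and the claim is the sup bound itself. *)
rewrite mulr0 subr0 powRr1 ?(ltW X0)//.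
case: ifPn => _; last by rewrite lee_fin !mulr_ge0// ltW.
by apply/ess_supP; apply: filterS gM => x xM; rewrite /= lee_fin.
Qed.

End interpolation.

(** The estimates hold for each positive [d] strictly above the norm [nu], which may itself be 0;
    this lets [d] decrease to [nu]. Exceeding [nu] by at most [z / K] costs at most [z]. *)
Lemma lee_mul_of_gt (R : realType) (L nu : \bar R) (K e : R) :
  (0 <= L)%E -> (0 <= nu)%E -> (nu < e%:E)%E -> 0 < K ->
  (forall d : R, 0 < d < e -> (nu < d%:E)%E -> (L <= (K * d)%:E)%E) ->
  (L <= K%:E * nu)%E.
Proof.
move=> L0 nu0 nue K0 HL.
have /fineK nuE : nu \is a fin_num by rewrite ge0_fin_numE// (lt_trans nue)// ltry.
move: nu0 nue HL; rewrite -nuE; set r := fine nu; rewrite lee_fin lte_fin => r0 re HL.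
rewrite -EFinM; apply/lee_addgt0Pr => z z0; rewrite -EFinD.
pose d := r + Num.min ((e - r) / 2) (z / K).
have zK : 0 < z / K by rewrite divr_gt0.
have mn : 0 < Num.min ((e - r) / 2) (z / K) by rewrite lt_min zK andbT; lra.
have mn1 : Num.min ((e - r) / 2) (z / K) <= (e - r) / 2 by rewrite ge_min lexx.
have mn2 : Num.min ((e - r) / 2) (z / K) <= z / K by rewrite ge_min lexx orbT.
apply: (@le_trans _ _ (K * d)%:E).
  by apply: HL; rewrite ?lte_fin /d; [apply/andP; split|]; lra.
rewrite lee_fin /d mulrDr lerD2l mulrC -ler_pdivlMr//.
Qed.

Theorem theorem2p1 (R : realType) (n : nat) (hn : (1 <= n)%N) :
  exists eps C : R, [/\ 0 < eps, 0 < C &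
    forall (phi : euclidean R n -> R) (u : R -> euclidean R n -> R),
      expL2 phi ->
      {ae lebesgueRn R n, forall x, 0 <= phi x} ->
      unique_admissible_solution phi u ->
      (expL2_norm phi < eps%:E)%E ->
      forall q : \bar R, (2%:E <= q)%E ->
      forall t : R, 0 < t ->
        (Lnorm (lebesgueRn R n) q (EFin \o u t) <=
         (C * t `^ (- (n%:R / 2) * (1 / 2 - fine q^-1)))%:E
           * expL2_norm phi)%E].
Proof.
have [eps eps0 decay] := @mild_solution_decay R n hn.
exists eps, 3; split => // phi u [[mphi _] _] _ [[[uexp _ _ ueq _] upos usup] _] phie.
move=> q q2 t t0.
have mu_ s : 0 < s -> measurable_fun setT (u s).
  by move=> /uexp[[]].
have phi0 : (0 <= expL2_norm phi)%E.
  by apply/ereal_infP => _ [l [l0 _] <-]; rewrite lee_fin ltW.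
apply: (lee_mul_of_gt _ phi0 phie) => //.
- exact: Lnorm_ge0.
- by rewrite mulr_gt0// powR_gt0.
move=> d /andP[d0 de] phid.
have [_ phi1] := modular_le1 phid.
have um s : 0 < s -> (modular young_exp2 (2 * d) (u s) <= 1)%E.
  move=> s0; apply: (modular_le1 _).2.
  apply: (@le_lt_trans _ _ (2%:E * expL2_norm phi)%E).
    by apply: le_trans usup; apply: ereal_sup_ubound; exists s.
  by rewrite EFinM lte_pmul2l// lte_fin.
have d0e : 0 < d < eps by rewrite d0.
have ut := decay d phi u d0e mphi phi1 mu_ um ueq upos t t0.
have tX : 0 < t `^ (- (n%:R / 4)) by exact: powR_gt0.
apply: le_trans (Lnorm_interpolation q2 d0 tX (mu_ t t0) (um t t0) ut) _.
(* Both exponents agree, since [N / 4 * (1 - 2 / q) = N / 2 * (1 / 2 - 1 / q)]. *)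
rewrite lee_fin -powRrM mulrAC le_eqVlt; apply/orP; left; apply/eqP.
by congr (_ * _ `^ _ * _); field.
Qed.
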